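(* Let $Q$ be a space of quantities over a field $F$ with group of dimensions $\mathcal{D}$, free of zero divisors, and let $\sigma:\mathcal{D}\to Q$ be a system of units. Then the map $\nu:Q\to F$, $\nu(q)=q\,\sigma(\dim(q))^{-1}$ (the quantity of dimension one on the right being identified with an element of $F$), is (i) an $F$-linear homomorphism, i.e. $\nu(\alpha q_1+\beta q_2)=\alpha\nu(q_1)+\beta\nu(q_2)$ for all $q_1,q_2$ in the same fiber of $Q$ and all $\alpha,\beta\in F$; and (ii) a homomorphism with respect to the product of quantities (i.e. $\nu(qr)=\nu(q)\nu(r)$ for all $q,r\in Q$) if and only if $\sigma$ is a coherent section.
   Context: A group of dimensions is a finitely generated free Abelian group $\mathcal{D}$, written multiplicatively with identity $1_{\mathcal{D}}$. A space of quantities with group of dimensions $\mathcal{D}$ over a field $F$ is a set $Q$ together with a surjective map $\dim:Q\to\mathcal{D}$ such that: (i) for each $A\in\mathcal{D}$ the fiber $\dim^{-1}(A)$ has the structure of a one-dimensional vector space over $F$; (ii) there is a product on $Q$ making it an Abelian monoid (identity $1_Q$), and $\dim$ is a monoid homomorphism, $\dim(qr)=\dim(q)\dim(r)$; (iii) $q(r_1+r_2)=qr_1+qr_2$ whenever $q,r_1,r_2\in Q$ with $\dim(r_1)=\dim(r_2)$, and $\alpha(qr)=(\alpha q)r$ for $q,r\in Q$, $\alpha\in F$. A zero of $Q$ is the zero vector of some fiber (each fiber has its own zero); an element is nonzero if it is not a zero. $Q$ is free of zero divisors if there are no nonzero $q,r\in Q$ such that $qr$ is a zero. In a space of quantities free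 of zero divisors every nonzero quantity has an inverse for the product, so $\sigma(\dim(q))^{-1}$ makes sense. A section of $Q$ is a map $\sigma:\mathcal{D}\to Q$ with $\dim\circ\sigma=\mathrm{id}_{\mathcal{D}}$. It is coherent if it is a homomorphism for the products: $\sigma(AB)=\sigma(A)\sigma(B)$ for all $A,B\in\mathcal{D}$. It is a nonzero section if none of its values is a zero. A system of units is a nonzero section (not necessarily coherent). The fiber $\dim^{-1}(1_{\mathcal{D}})$ of quantities of dimension one is identified with $F$ through the isomorphism $\alpha\mapsto\alpha 1_Q$; thus $\nu(q)$ is the unique scalar with $q\,\sigma(\dim(q))^{-1}=\nu(q)1_Q$. *)

(* Defs.v *)
From HB Require Import structures.
From mathcomp Require Import all_boot all_algebra.
From mathcomp Require Import boolp classical_sets.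

Set Implicit Arguments.
Unset Strict Implicit.
Unset Printing Implicit Defensive.

Import GRing.Theory.

Local Open Scope group_scope.

(* D is isomorphic to Z^n for some n; commutativity of D follows from that
   of the additive group 'rV[int]_n. *)
Definition free_abelian_fg (D : groupType) : Prop :=
  exists (n : nat) (f : 'rV[int]_n -> D),
    bijective f /\ (forall u v, f (u + v)%R = f u * f v).

(* In pre_space only the fibers carry a linear structure: there is no addition
   on the whole of the carrier. *)
Record pre_space (F : fieldType) (D : groupType) := PreSpace {
  quantity :> monoidType;
  qdim : quantity -> D;
  fiber_class : forall A : D, GRing.Lmodule F {q : quantity | qdim q = A}
}.

Section PreSpace.
Variables (F : fieldType) (D : groupType) (Q : pre_space F D).

Definition fiber (A : D) : Type := {q : Q | qdim q = A}.

HB.instance Definition _ (A : D) : GRing.Lmodule F (fiber A) :=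
  fiber_class Q A.

Definition to_fiber (q : Q) : fiber (qdim q) := exist _ q erefl.

(* The action of F on the whole of Q, in the fiber of each quantity. *)
Definition qscale (a : F) (q : Q) : Q := sval (a *: to_fiber q)%R.

Definition qzero (A : D) : Q := sval (0%R : fiber A).

Definition is_zero (q : Q) : Prop := exists A : D, q = qzero A.

Definition no_zero_divisors : Prop :=
  ~ exists q r : Q, [/\ ~ is_zero q, ~ is_zero r & is_zero (q * r)].

Section Mul.
Hypothesis qdimM : {morph @qdim F D Q : q r / q * r >-> q * r}.

Lemma fiber_mul_subproof (q : Q) (A : D) (r : fiber A) :
  qdim (q * sval r) = qdim q * A.
Proof. by rewrite qdimM (svalP r). Qed.

Definition fiber_mul (q : Q) (A : D) (r : fiber A) : fiber (qdim q * A) :=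
  exist _ (q * sval r) (fiber_mul_subproof q r).

End Mul.

Definition is_section (sigma : D -> Q) : Prop := cancel sigma (@qdim F D Q).

Definition coherent (sigma : D -> Q) : Prop :=
  {morph sigma : A B / A * B >-> A * B}.

Definition nonzero_section (sigma : D -> Q) : Prop :=
  is_section sigma /\ (forall A, ~ is_zero (sigma A)).

Definition system_of_units (sigma : D -> Q) : Prop := nonzero_section sigma.

(* The inverse of q, and 1 if there is none; cf. qmulV. *)
Definition qinv (q : Q) : Q := xget 1 [set r : Q | q * r = 1].

(* The scalar a with q = a 1_Q, and 0 if there is none; cf. scalar_ofK. *)
Definition scalar_of (q : Q) : F := xget 0%R [set a : F | q = qscale a 1].

Definition nu (sigma : D -> Q) (q : Q) : F :=
  scalar_of (q * qinv (sigma (qdim q))).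

End PreSpace.

Record space_of_quantities (F : fieldType) (D : groupType) :=
SpaceOfQuantities {
  space :> pre_space F D;
  qdim_surj : forall A : D, exists q : space, qdim q = A;
  fiber_dim1 : forall A : D, inhabited (Vector.axiom 1 (fiber space A));
  qmulC : forall q r : space, q * r = r * q;
  qdim1 : qdim (1 : space) = 1;
  qdimM : {morph @qdim F D space : q r / q * r >-> q * r};
  qmulDr : forall (q : space) (A : D) (r1 r2 : fiber space A),
    fiber_mul qdimM q (r1 + r2)%R
      = (fiber_mul qdimM q r1 + fiber_mul qdimM q r2)%R;
  qscaleAl : forall (a : F) (q r : space),
    qscale a (q * r) = qscale a q * r
}.

(* qinv and scalar_of never take their default value in nu. *)
Section WellDefined.
Variables (F : fieldType) (D : groupType) (Q : space_of_quantities F D).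

Lemma fiber_inj (A : D) : injective (sval : fiber Q A -> Q).
Proof.
move=> [x hx] [y hy] /= exy; subst y; congr exist; exact: eq_irrelevance.
Qed.

Lemma qscale_sval (A : D) (a : F) (r : fiber Q A) :
  qscale a (sval r) = sval (a *: r)%R.
Proof. by case: r => q hq /=; subst A. Qed.

Lemma is_zeroP (A : D) (r : fiber Q A) : is_zero (sval r) <-> r = 0%R.
Proof.
split=> [[B hB]|->]; last by exists A.
have AB : A = B by rewrite -(svalP r) hB (svalP (0%R : fiber Q B)).
by subst B; apply: fiber_inj.
Qed.

Lemma fiber_span (A : D) (u v : fiber Q A) :
  u <> 0%R -> exists a : F, v = (a *: u)%R.
Proof.
have [[f fL [g fK gK]]] := fiber_dim1 Q A.
have f0 : f 0%R = 0%R by have := fL (- 1)%R 0%R 0%R; rewrite scaler0 addr0 scaleN1r addNr.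
move=> u0; have fu0 : f u ord0 ord0 != 0%R.
  apply/eqP => fu; apply: u0; apply: (can_inj fK); rewrite f0.
  by apply/matrixP => i j; rewrite !ord1 fu mxE.
exists (f v ord0 ord0 / f u ord0 ord0)%R; apply: (can_inj fK).
have := fL (f v ord0 ord0 / f u ord0 ord0)%R u 0%R.
rewrite f0 !addr0 => ->; apply/matrixP => i j; rewrite !ord1 mxE.
by rewrite divfK.
Qed.

Lemma exists_nonzero (A : D) : exists u : fiber Q A, u <> 0%R.
Proof.
have [[f fL [g fK gK]]] := fiber_dim1 Q A.
have f0 : f 0%R = 0%R by have := fL (- 1)%R 0%R 0%R; rewrite scaler0 addr0 scaleN1r addNr.
exists (g (const_mx 1%R)) => /(congr1 f); rewrite gK f0 => /matrixP/(_ 0%R 0%R).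
by rewrite !mxE => /eqP; rewrite oner_eq0.
Qed.

Lemma qscale0 (q : Q) : is_zero (qscale 0%R q).
Proof. by rewrite /qscale scale0r; exists (qdim q). Qed.

Lemma qscale_zero (a : F) (q : Q) : is_zero q -> is_zero (qscale a q).
Proof. by case=> A ->; rewrite /qzero qscale_sval scaler0; exists A. Qed.

Lemma one_nonzero : ~ is_zero (1 : Q).
Proof.
have [u u0] := exists_nonzero 1; case=> A hA; apply: u0; apply/is_zeroP.
have -> : sval u = qscale 0%R 1 * sval u.
  by rewrite {1}hA /qzero qscale_sval scale0r -/(qzero Q A) -hA mul1g.
by rewrite -qscaleAl; apply: qscale0.
Qed.

Lemma scalar_spec (q : Q) : qdim q = 1 -> exists a : F, q = qscale a 1.
Proof.
move=> hq; pose v : fiber Q 1 := exist _ q hq.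
pose u : fiber Q 1 := exist _ 1 (qdim1 Q).
have u0 : u <> 0%R by move/is_zeroP; apply: one_nonzero.
have [a ha] := fiber_span v u0; exists a.
by change (sval v = qscale a (sval u)); rewrite ha qscale_sval.
Qed.

Lemma scalar_ofK (q : Q) : qdim q = 1 -> q = qscale (scalar_of q) 1.
Proof.
by move=> /scalar_spec ha; apply: (xgetPex 0%R (P := [set a | q = qscale a 1])).
Qed.

Hypothesis Q0 : no_zero_divisors Q.

Lemma qmulV (q : Q) : ~ is_zero q -> q * qinv q = 1.
Proof.
move=> q0; apply: (xgetPex 1 (P := [set r | q * r = 1])).
have [u u0] := exists_nonzero (qdim q)^-1.
have [a ha] : exists a : F, q * sval u = qscale a 1.
  by apply: scalar_spec; rewrite qdimM (svalP u) mulgV.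
exists (qscale a^-1%R (sval u)) => /=.
rewrite qmulC -qscaleAl qmulC ha qscale_sval scalerA.
have [a0|a0] := eqVneq a 0%R; last by rewrite mulVf // scale1r.
exfalso; apply: Q0; exists q, (sval u); split=> //; first by move/is_zeroP.
by rewrite ha a0; apply: qscale0.
Qed.

Lemma nu_spec (sigma : D -> Q) (q : Q) : system_of_units sigma ->
  q * qinv (sigma (qdim q)) = qscale (nu sigma q) 1.
Proof.
case=> sK s0; apply: scalar_ofK.
have := congr1 (@qdim F D Q) (qmulV (@s0 (qdim q))).
by rewrite !qdimM sK qdim1.
Qed.

End WellDefined.

(* Main.v *)
(* Every quantity q is the multiple nu(q) sigma(dim q) of the unit of its
   dimension, and nu(q) is the only such coefficient because sigma(dim q) is not
   a zero.  Both parts compare coefficients; for the converse in (ii) one uses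
   that nu takes the value 1 exactly at the units. *)
Require Import Defs.
From mathcomp Require Import all_boot all_algebra.

Import GRing.Theory.
Local Open Scope ring_scope.

Section Scale.
Context {F : fieldType} {D : groupType} {Q : space_of_quantities F D}.
Implicit Types (a b : F) (q r : Q).

Lemma qscale1 q : qscale 1 q = q.
Proof. by rewrite /qscale scale1r. Qed.

Lemma qscaleA a b q : qscale a (qscale b q) = qscale (a * b) q.
Proof. by rewrite {2}/qscale qscale_sval scalerA. Qed.

Lemma qscaleAr a q r : qscale a (q * r)%g = (q * qscale a r)%g.
Proof. by rewrite qmulC qscaleAl qmulC. Qed.

Lemma qscale_inj q a b : ~ is_zero q -> qscale a q = qscale b q -> a = b.
Proof.
(* Subtraction exists only inside a fiber, so the equality is first moved to the fiber of [q]. There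
   a nonzero [a - b] could be cancelled, making [q] a zero. *)
move=> q0 /fiber_inj /eqP; rewrite -subr_eq0 -scalerBl => /eqP ab0.
have [/eqP|ab] := eqVneq (a - b) 0; first by rewrite subr_eq0 => /eqP.
case: q0; apply/(is_zeroP (to_fiber q)).
by rewrite -[to_fiber q]scale1r -(mulVf ab) -scalerA ab0 scaler0.
Qed.

End Scale.

Section Measure.
Context {F : fieldType} {D : groupType} {Q : space_of_quantities F D}.
Hypothesis hQ : no_zero_divisors Q.
Context {sigma : D -> Q}.
Hypothesis hsigma : system_of_units sigma.

(** Multiply the defining equation of [nu sigma q] by the unit [sigma (qdim q)], which cancels its
    inverse. *)
Lemma nu_scale (q : Q) : qscale (nu sigma q) (sigma (qdim q)) = q.
Proof.
have s0 := proj2 hsigma (qdim q).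
rewrite -[X in qscale _ X]mul1g qscaleAl -(nu_spec hQ q hsigma).
by rewrite -mulgA [X in (q * X)%g]qmulC (qmulV hQ s0) mulg1.
Qed.

Lemma nu_eq (q : Q) (a : F) : q = qscale a (sigma (qdim q)) -> nu sigma q = a.
Proof.
by move=> qa; apply: (qscale_inj _ _ _ (proj2 hsigma (qdim q))); rewrite nu_scale.
Qed.

Lemma nu_unit (A : D) : nu sigma (sigma A) = 1.
Proof. by apply: nu_eq; rewrite (proj1 hsigma) qscale1. Qed.

Lemma nu_linear (A : D) (q1 q2 : fiber Q A) (a b : F) :
  nu sigma (sval (a *: q1 + b *: q2))
    = a * nu sigma (sval q1) + b * nu sigma (sval q2).
Proof.
(* The unit [sigma A], seen as a vector, is a common basis of the fiber for [q1] and [q2]. *)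
pose u : fiber Q A := exist _ (sigma A) (proj1 hsigma A).
have nuE (q : fiber Q A) : q = nu sigma (sval q) *: u.
  by apply: fiber_inj; rewrite -qscale_sval -{1}[sval q]nu_scale (svalP q).
apply: nu_eq; rewrite (svalP (a *: q1 + b *: q2)).
rewrite -[sigma A]/(sval u) qscale_sval scalerDl -!scalerA.
by rewrite -!nuE.
Qed.

Lemma nuM_coherent :
  (forall q r : Q, nu sigma (q * r)%g = nu sigma q * nu sigma r)
    <-> coherent sigma.
Proof.
split=> [nuM A B | sM q r].
  (* [sigma A * sigma B] has coefficient 1 * 1 = 1, so it is the unit of its own dimension
     [A * B]. *)
  rewrite -[RHS]nu_scale nuM !nu_unit mulr1 qscale1.
  by rewrite qdimM !(proj1 hsigma).
apply: nu_eq.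
(* By coherence, the scalars [nu sigma q] and [nu sigma r] can be moved each onto its own unit. *)
by rewrite qdimM sM -qscaleA qscaleAr qscaleAl !nu_scale.
Qed.

End Measure.

Theorem proposition2p11 (F : fieldType) (D : groupType)
    (hD : free_abelian_fg D) (Q : space_of_quantities F D)
    (hQ : no_zero_divisors Q) (sigma : D -> Q)
    (hsigma : system_of_units sigma) :
  (forall (A : D) (q1 q2 : fiber Q A) (a b : F),
     nu sigma (sval (a *: q1 + b *: q2))
       = a * nu sigma (sval q1) + b * nu sigma (sval q2))
  /\ ((forall q r : Q, nu sigma (q * r)%g = nu sigma q * nu sigma r)
      <-> coherent sigma).
Proof.
split; [exact: nu_linear | exact: nuM_coherent].
Qed.
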